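(* Let $W=W^{p,q}([m])=V_0\oplus V_1\oplus V_2\oplus V_3$ be the finite-dimensional complex vector space with the operators $E_{11},E_{22},E_{33},L,E_{12},E_{21},E_{23},E_{32}$ given explicitly in the context, for the highest weight $[m]=[m_{13},m_{23},m_{33}]$. Suppose that (class 2) $$[l_{13}+l_{33}+3]\neq0\quad\text{and}\quad[l_{23}+l_{33}+3]=0 .$$ Then the invariant subspace $I_2$ of $W$ for which the factor representation in $W/I_2$ is irreducible is $$I_2=V_3\oplus V_1 .$$
   Context: Parameters. $p,q$ are nonzero complex numbers, generic: none of $p$, $q$, $pq$ is a root of unity. Logarithms $\log p,\log q$ are fixed and $p^x=e^{x\log p}$, $q^x=e^{x\log q}$, $(p/q)^x=p^xq^{-x}$, $(q/p)^x=q^xp^{-x}$ for $x\in\mathbb C$. For $x\in\mathbb C$ put $[x]=\dfrac{q^{x}-p^{-x}}{q-p^{-1}}$. For every integer $n\ge 0$ a square root $[n]^{1/2}$ is fixed, and square roots of products and quotients of such numbers are understood multiplicatively. Weights. $m_{13},m_{23},m_{33}\in\mathbb C$ with $m_{13}-m_{23}\in\mathbb Z_{\ge 0}$. Put $l=\tfrac12(m_{13}-m_{23})$, $l_{13}=m_{13}-1$, $l_{23}=m_{23}-2$, $l_{33}=m_{33}-1$. The numbers $a_1,a_2,a_3$ are arbitrary fixed nonzero complex parameters. The space. For $k=0,1,2,3$ let $(m_{12},m_{22},m_{31})$ be, respectively, $(m_{13},\,m_{23},\,m_{33})$; $(m_{13},\,m_{23}-1,\,m_{33}+1)$; $(m_{13}-1,\,m_{23},\,m_{33}+1)$;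 $(m_{13}-1,\,m_{23}-1,\,m_{33}+2)$. Let $V_k$ be the vector space with basis the symbols $(m)_k$ indexed by all $m_{11}$ with $m_{12}-m_{11}\in\mathbb Z_{\ge0}$ and $m_{11}-m_{22}\in\mathbb Z_{\ge0}$ (so $V_2=0$ if $m_{13}=m_{23}$). Put $W=V_0\oplus V_1\oplus V_2\oplus V_3$, write $(m)=(m)_0$, and $l_{11}=m_{11}-1$, $l_{12}=m_{12}-1$, $l_{22}=m_{22}-2$. The vector $(m)_k^{\pm 11}$ is obtained from $(m)_k$ by replacing $m_{11}$ with $m_{11}\pm1$. A term whose symbol is not one of the basis vectors is read as $0$. Action of the even generators of $U_{p,q}[gl(2/1)]$ (for each $k$, with the $m_{12},m_{22},m_{31}$ of $V_k$): $E_{11}(m)_k=(l_{11}+1)(m)_k$; $E_{22}(m)_k=(l_{12}+l_{22}-l_{11}+2)(m)_k$; $E_{33}(m)_k=m_{31}(m)_k$; $L(m)_k=\tfrac12(l_{12}-l_{22}-1)(m)_k$; $E_{12}(m)_k=([l_{12}-l_{11}][l_{11}-l_{22}])^{1/2}(m)_k^{+11}$; $E_{21}(m)_k=([l_{12}-l_{11}+1][l_{11}-l_{22}-1])^{1/2}(m)_k^{-11}$. Action of the odd generators (all symbols in a given formula have the same $m_{11}$): $E_{23}(m)=0$; $E_{23}(m)_1=a_1(p/q)^{l_{23}+l_{33}+3}\left(\frac{[l_{11}-l_{23}]}{[2l+1]}\right)^{1/2}[l_{23}+l_{33}+3]\,(m)$; $E_{23}(m)_2=a_2(p/q)^{l_{23}+l_{33}+4}\left(\frac{[l_{13}-l_{11}]}{[2l]}\right)^{1/2}[l_{13}+l_{33}+3]\,(m)$;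 $E_{23}(m)_3=a_3(p/q)^{l_{13}+l_{23}+l_{33}-l_{11}+2}\Big\{\frac{1}{a_1q}\left(\frac{[l_{13}-l_{11}]}{[2l+1]}\right)^{1/2}[l_{13}+l_{33}+3]\,(m)_1-\frac{1}{a_2p}([l_{11}-l_{23}][2l])^{1/2}\frac{[l_{23}+l_{33}+3]}{[2l+1]}\,(m)_2\Big\}$; $E_{32}(m)=\frac1{a_1}\left(\frac{[l_{11}-l_{23}]}{[2l+1]}\right)^{1/2}(m)_1+\frac1{a_2}(p/q)^{l_{13}-l_{11}-1}\frac{([l_{13}-l_{11}][2l])^{1/2}}{[2l+1]}\,(m)_2$; $E_{32}(m)_1=\frac{a_1}{a_3}\,p\left(\frac{[l_{13}-l_{11}]}{[2l+1]}\right)^{1/2}(m)_3$; $E_{32}(m)_2=-\frac{a_2}{a_3}\,p\,(q/p)^{l_{13}-l_{11}-1}\left(\frac{[l_{11}-l_{23}]}{[2l]}\right)^{1/2}(m)_3$; $E_{32}(m)_3=0$. A subspace of $W$ is invariant if it is stable under all eight kinds of operators $E_{11},E_{22},E_{33},L,E_{12},E_{21},E_{23},E_{32}$; a representation is irreducible if it is nonzero and has no invariant subspaces other than $0$ and itself. *)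

(* Defs.v *)
(* MathComp with MathComp-Analysis. The complex numbers are R[i], R : realType. *)
From HB Require Import structures.
From mathcomp Require Import all_boot all_order all_algebra.
From mathcomp Require Import generic_quotient ring_quotient complex.
From mathcomp Require Import reals sequences trigo ring.

Set Implicit Arguments.
Unset Strict Implicit.
Unset Printing Implicit Defensive.

Import Order.TTheory GRing.Theory Num.Theory.
Local Open Scope ring_scope.
Local Open Scope quotient_scope.

(* The library has quotients of Z-modules by subgroups; the scalar action and
   the finite dimension are added here. *)
Section QuotientSpace.
Variables (K : fieldType) (V : vectType K) (U : {vspace V}).

Definition quotv : Type := Quotient.quot U.
HB.instance Definition _ := GRing.Zmodule.on quotv.
HB.instance Definition _ := EqQuotient.on quotv.

Lemma pi_quotv_eq (x y : V) :
  (\pi_quotv x == \pi_quotv y) = (x - y \in U).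
Proof. by rewrite (Quotient.idealrBE U x y). Qed.

Lemma pi_quotvD (x y : V) : \pi_quotv (x + y) = \pi_quotv x + \pi_quotv y.
Proof. exact: (Quotient.pi_add U x y). Qed.

Definition scaleq (a : K) (x : quotv) : quotv := \pi_quotv (a *: repr x).

Lemma pi_quotvZ a (x : V) : \pi_quotv (a *: x) = scaleq a (\pi_quotv x).
Proof.
apply/eqP; rewrite pi_quotv_eq -scalerBr rpredZ //.
by rewrite -pi_quotv_eq reprK.
Qed.

Fact scaleqA a b x : scaleq a (scaleq b x) = scaleq (a * b) x.
Proof. by elim/quotW: x => x; rewrite -(pi_quotvZ b x) -!(pi_quotvZ _ (_ *: x)) -!(pi_quotvZ _ x) scalerA. Qed.
Fact scale1q : left_id 1 scaleq.
Proof. by elim/quotW=> x; rewrite -pi_quotvZ scale1r. Qed.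
Fact scaleqDr : right_distributive scaleq +%R.
Proof.
move=> a; elim/quotW=> x; elim/quotW=> y.
by rewrite -pi_quotvD -(pi_quotvZ a x) -(pi_quotvZ a y) -(pi_quotvZ a (x + y)) -pi_quotvD
  scalerDr.
Qed.
Fact scaleqDl x : {morph scaleq^~ x : a b / a + b}.
Proof.
by move=> a b; elim/quotW: x => x; rewrite -!(pi_quotvZ _ x) -pi_quotvD scalerDl.
Qed.

HB.instance Definition _ := GRing.Zmodule_isLmodule.Build K quotv
  scaleqA scale1q scaleqDr scaleqDl.

Lemma pi_quotv_linear : linear \pi_quotv.
Proof. by move=> a x y; rewrite pi_quotvD pi_quotvZ. Qed.

Fact quotv_vect_iso : Vector.axiom (\dim U^C) quotv.
Proof.
have UUC : (U + U^C = fullv)%VS by exact: addv_complf.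
have capUC : (U :&: U^C = 0)%VS by exact: capv_compl.
pose prj (x : V) := daddv_pi U^C U x.
have prj_in x : prj x \in U^C%VS by exact: memv_pi.
have capCU : (U^C :&: U = 0)%VS by rewrite capvC.
have prj_mod x : x - prj x \in U.
  have xin : x \in (U^C + U)%VS by rewrite addvC UUC memvf.
  by rewrite -{1}(daddv_pi_add capCU xin) addrC addKr memv_pi.
have prj0 x : x \in U -> prj x = 0.
  move=> xU; apply/eqP; rewrite -memv0 -capUC memv_cap prj_in andbT.
  by rewrite -[prj x](subKr x) rpredB.
have prj_id x : x \in U^C%VS -> prj x = x.
  by move=> xU; rewrite /prj daddv_pi_id.
have prjB x y : prj (x - y) = prj x - prj y by rewrite /prj linearB.
have prj_pi (x : V) : prj (repr (\pi_quotv x)) = prj x.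
  by apply/eqP; rewrite -subr_eq0 -prjB prj0 // -pi_quotv_eq reprK.
have [f f_lin f_bij] := subvs_vect_iso U^C.
exists (fun x : quotv => f (vsproj U^C (prj (repr x)))).
  move=> a; elim/quotW=> x; elim/quotW=> y; rewrite -pi_quotv_linear !prj_pi.
  by rewrite /prj !linearP f_lin.
case: f_bij => g fK gK; exists (fun r => \pi_quotv (vsval (g r))).
  move=> x; rewrite fK vsprojK ?prj_in // -[RHS]reprK; apply/eqP.
  by rewrite pi_quotv_eq -opprB rpredN.
by move=> r; rewrite prj_pi prj_id ?subvsP // vsvalK gK.
Qed.

HB.instance Definition _ := Lmodule_hasFinDim.Build K quotv quotv_vect_iso.

End QuotientSpace.

(* A representation is given by the family rho of the operators of the
   generators. *)
Section Representations.
Variables (K : fieldType) (V : vectType K) (T : Type) (rho : T -> 'End(V)).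

Definition invariant_sub (U : {vspace V}) : Prop :=
  forall g, (rho g @: U <= U)%VS.

Definition irreducible_rep : Prop :=
  ({:V} != 0)%VS /\
  forall U : {vspace V}, invariant_sub U -> U = 0%VS \/ U = fullv.

(* The operators x + U |-> rho g x + U; meaningful only for invariant U
   (see quot_repE). *)
Definition quot_rep (U : {vspace V}) (g : T) : 'End(quotv U) :=
  linfun (fun x : quotv U => \pi_(quotv U) (rho g (repr x))).

Lemma quot_repE (U : {vspace V}) g (x : V) : invariant_sub U ->
  quot_rep U g (\pi_(quotv U) x) = \pi_(quotv U) (rho g x).
Proof.
move=> Uinv; have rhoE (y : V) :
    \pi_(quotv U) (rho g (repr (\pi_(quotv U) y))) = \pi_(quotv U) (rho g y).
  apply/eqP; rewrite pi_quotv_eq -linearB; apply: (subvP (Uinv g)).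
  by rewrite memv_img // -pi_quotv_eq reprK.
pose f (y : quotv U) : quotv U := \pi_(quotv U) (rho g (repr y)).
have fl : linear f.
  move=> a; elim/quotW=> u; elim/quotW=> v; rewrite /f.
  by rewrite -pi_quotv_linear !rhoE linearP pi_quotv_linear.
pose fL := HB.pack_for {linear quotv U -> quotv U} f
  (GRing.isLinear.Build K (quotv U) (quotv U) *:%R f fl).
by rewrite -[quot_rep U g]/(linfun fL) lfunE /= /f rhoE.
Qed.

End Representations.

Arguments quot_rep {K V T} rho U g.

Section Module.
Variable R : realType.
Notation C := R[i].

Definition cexp (z : C) : C :=
  let: Complex x y := z in Complex (expR x * cos y) (expR x * sin y).

Variables (p q lp lq : C).

Definition ppow (x : C) : C := cexp (x * lp).
Definition qpow (x : C) : C := cexp (x * lq).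
Definition pqpow (x : C) : C := ppow x * qpow (- x).
Definition qppow (x : C) : C := qpow x * ppow (- x).

Definition br (x : C) : C := (qpow x - ppow (- x)) / (q - p^-1).

(* sq n is the chosen square root of [n]. In the formulas below rt is only
   applied to complex numbers which are natural numbers. *)
Variable sq : nat -> C.
Definition rt (x : C) : C := sq (Num.truncn (complex.Re x)).

(* n stands for m13 - m23 = 2l; the theorem assumes m13 - m23 = n%:R. *)
Variables (n : nat) (m13 m23 m33 a1 a2 a3 : C).

Definition m12 (k : nat) : C :=
  match k with 0 => m13 | 1 => m13 | 2 => m13 - 1 | _ => m13 - 1 end.
Definition m22 (k : nat) : C :=
  match k with 0 => m23 | 1 => m23 - 1 | 2 => m23 | _ => m23 - 1 end.
Definition m31 (k : nat) : C :=
  match k with 0 => m33 | 1 => m33 + 1 | 2 => m33 + 1 | _ => m33 + 2 end.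

(* m12 k - m22 k + 1, the number of symbols (m)_k. *)
Definition nlab (k : nat) : nat :=
  match k with 0 => n.+1 | 1 => n.+2 | 2 => n | _ => n.+1 end.

(* The label (k, i) is the symbol (m)_k with m11 = m22 k + i. *)
Definition label := {k : 'I_4 & 'I_(nlab k)}.
Definition m11 (u : label) : C := m22 (tag u) + (tagged u : nat)%:R.

Lemma m11P (k : 'I_4) (x : C) : m13 - m23 = n%:R ->
  (exists u : label, tag u = k /\ m11 u = x) <->
  (exists a : nat, m12 k - x = a%:R) /\ (exists b : nat, x - m22 k = b%:R).
Proof.
move=> mn.
have dk : m12 k - m22 k + 1 = (nlab k)%:R.
  by case: k => [[|[|[|[|//]]]] lt] /=; rewrite -?natr1 -mn; ring.
split=> [[[k' i] [/= kk' <-]]|[[a ax] [b bx]]].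
  move: i; rewrite {}kk' => i; rewrite /m11 /=; split; last by exists i; ring.
  have ilt : (i.+1 <= nlab k)%N := ltn_ord i.
  exists (nlab k - i.+1)%N; rewrite natrB // -dk -natr1; ring.
have bk : (b < nlab k)%N.
  suff -> : nlab k = (a + b).+1 by rewrite ltnS leq_addl.
  apply/eqP; rewrite -(eqr_nat C) -dk -natr1 natrD -ax -bx; apply/eqP; ring.
by exists (existT _ k (Ordinal bk)); rewrite /m11 /= -bx; split=> //; ring.
Qed.

(* The space with basis the disjoint union of the bases of V_0, ..., V_3. *)
Definition W := {ffun label -> C^o}.
Definition bvec (u : label) : W := [ffun v => (v == u)%:R].
Definition V (k : nat) : {vspace W} :=
  (\sum_(u : label | tag u == k :> nat) <[bvec u]>)%VS.

Lemma V_supp (k : nat) (w : W) (u : label) :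
  w \in V k -> tag u != k :> nat -> w u = 0.
Proof.
move=> /memv_sumP[f fP ->] uk; rewrite sum_ffunE big1 // => v vk.
have /vlineP[c ->] := fP v vk; rewrite !ffunE.
by case: (u =P v) uk => [->|_ _]; [rewrite vk | exact: scaler0].
Qed.

Lemma V_independent (f : 'I_4 -> W) :
  (forall k, f k \in V k) -> \sum_k f k = 0 -> forall k, f k = 0.
Proof.
move=> fV f0 k; apply/ffunP => u.
have := congr1 (fun w : W => w u) f0; rewrite sum_ffunE ffunE => fu0.
have [uk|uk] := eqVneq (tag u) k; last first.
  by apply: (V_supp (fV k)); rewrite (inj_eq val_inj).
rewrite -fu0 (bigD1 k) //= big1 ?addr0 // => j jk.
by apply: (V_supp (fV j)); rewrite (inj_eq val_inj) uk eq_sym.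
Qed.

Lemma V_full : (\sum_(k < 4) V k)%VS = fullv.
Proof.
apply/eqP; rewrite eqEsubv subvf; apply/subvP => w _.
suff -> : w = \sum_u w u *: bvec u.
  apply: rpred_sum => u _; apply: rpredZ.
  apply: (subvP (sumv_sup (tag u) _ (subvv _))) => //.
  by apply: (subvP (sumv_sup u _ (subvv _))); rewrite ?eqxx ?memv_line.
apply/ffunP => v; rewrite sum_ffunE (bigD1 v) //= big1 => [|u uv].
  by rewrite !ffunE eqxx addr0 [RHS]mulr1.
by rewrite !ffunE eq_sym (negPf uv) scaler0.
Qed.

(* The symbol (m)_k with m11 = x, which is 0 if it is not a basis vector. *)
Definition sym (k : nat) (x : C) : W :=
  \sum_(u : label | (tag u == k :> nat) && (m11 u == x)) bvec u.

Lemma sym_bvec (u : label) : sym (tag u) (m11 u) = bvec u.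
Proof.
rewrite /sym (bigD1 u) ?eqxx //= big1 ?addr0 // => -[k i] /andP[/andP[]].
case: u => k' j /= /eqP /val_inj kk'; move: j; rewrite -{}kk' => j.
by rewrite /m11 /= (inj_eq (addrI _)) eqr_nat => /eqP /val_inj ->; rewrite eqxx.
Qed.

Inductive gen := E11 | E22 | E33 | L | E12 | E21 | E23 | E32.

(* act g u is the image of the basis vector bvec u under g (rep_bvec). *)
Definition act (g : gen) (u : label) : W :=
  let k : nat := tag u in
  let l := (m13 - m23) / 2 in
  let l13 := m13 - 1 in let l23 := m23 - 2 in let l33 := m33 - 1 in
  let l11 := m11 u - 1 in let l12 := m12 k - 1 in let l22 := m22 k - 2 in
  let s j := sym j (m11 u) in
  match g with
  | E11 => (l11 + 1) *: s k
  | E22 => (l12 + l22 - l11 + 2) *: s k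
  | E33 => m31 k *: s k
  | L => ((l12 - l22 - 1) / 2) *: s k
  | E12 => (rt (l12 - l11) * rt (l11 - l22)) *: sym k (m11 u + 1)
  | E21 => (rt (l12 - l11 + 1) * rt (l11 - l22 - 1)) *: sym k (m11 u - 1)
  | E23 =>
    match k with
    | 0 => 0
    | 1 => (a1 * pqpow (l23 + l33 + 3) * (rt (l11 - l23) / rt (2 * l + 1))
            * br (l23 + l33 + 3)) *: s 0%N
    | 2 => (a2 * pqpow (l23 + l33 + 4) * (rt (l13 - l11) / rt (2 * l))
            * br (l13 + l33 + 3)) *: s 0%N
    | _ => (a3 * pqpow (l13 + l23 + l33 - l11 + 2)) *:
             (((a1 * q)^-1 * (rt (l13 - l11) / rt (2 * l + 1))
               * br (l13 + l33 + 3)) *: s 1%N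
              - ((a2 * p)^-1 * (rt (l11 - l23) * rt (2 * l))
                 * (br (l23 + l33 + 3) / br (2 * l + 1))) *: s 2%N)
    end
  | E32 =>
    match k with
    | 0 => (a1^-1 * (rt (l11 - l23) / rt (2 * l + 1))) *: s 1%N
           + (a2^-1 * pqpow (l13 - l11 - 1)
              * ((rt (l13 - l11) * rt (2 * l)) / br (2 * l + 1))) *: s 2%N
    | 1 => (a1 / a3 * p * (rt (l13 - l11) / rt (2 * l + 1))) *: s 3%N
    | 2 => - (a2 / a3 * p * qppow (l13 - l11 - 1)
              * (rt (l11 - l23) / rt (2 * l))) *: s 3%N
    | _ => 0
    end
  end.

Definition rep (g : gen) : 'End(W) :=
  linfun (fun w : W => \sum_u w u *: act g u).

Lemma rep_bvec (g : gen) (u : label) : rep g (bvec u) = act g u.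
Proof.
pose f (w : W) : W := \sum_u w u *: act g u.
have fl : linear f.
  move=> a x y; rewrite /f scaler_sumr -big_split /=; apply: eq_bigr => v _.
  by rewrite !ffunE scalerDl scalerA.
pose fL := HB.pack_for {linear W -> W} f (GRing.isLinear.Build C W W *:%R f fl).
rewrite -[rep g]/(linfun fL) lfunE /= /f (bigD1 u) //= big1 => [|v vu].
  by rewrite ffunE eqxx scale1r addr0.
by rewrite ffunE (negPf vu) scale0r.
Qed.

End Module.

(* Main.v *)
From HB Require Import structures.
Require Import Defs.
From mathcomp Require Import all_boot all_order all_algebra.
From mathcomp Require Import complex reals exp trigo ring.
Import Order.TTheory GRing.Theory Num.Theory.
Local Open Scope ring_scope.

(** The quotient W/I is irreducible exactly when I is a maximal proper
invariant subspace ([irreducible_quotP]), so it suffices to know all invariant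
subspaces of W: they are 0, V_3 + V_1 and W ([invariant_cases]).

The operators E11, E33 and L are diagonal in the symbols (m)_k, and their joint
eigenvalues separate the symbols ([wt_sep]).  Hence an invariant subspace is
spanned by the symbols it contains ([mem_basis]), and that set of symbols is
closed under passing from u to v whenever v occurs in E u for some generator E
([mem_act]).  Everything is thus read off a directed graph on the symbols.  By
genericity the bracket [d] is nonzero for every integer d > 0, so all the square
roots in the action are nonzero except those of [0].  Therefore E12 and E21 connect each V_k
([mem_block]).  Between the blocks, E32 leads from V_0 to V_1, from V_1 to V_3
and, when V_2 is nonzero, from V_0 to V_2; since [l13 + l33 + 3] <> 0, E23 leads
back from V_3 to V_1 and from V_2 to V_0.  Since [l23 + l33 + 3] = 0, E23
vanishes on V_1 and has no V_2 component on V_3, and nothing leads from V_1 or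
V_3 to V_0 or V_2 ([act_odd_even]).  The closed sets of symbols are thus the
empty set, the symbols with k odd, and all of them. *)

(** * Irreducible quotients and maximal invariant subspaces *)

Section MaximalSub.
Variables (K : fieldType) (V : vectType K) (T : Type) (rho : T -> 'End(V)).
Variable I : {vspace V}.

Definition quot_map : 'Hom(V, quotv I) :=
  linfun (HB.pack_for {linear V -> quotv I} \pi_(quotv I)%qT
    (GRing.isLinear.Build K V (quotv I) *:%R \pi_(quotv I)%qT
       (@pi_quotv_linear K V I))).

Lemma quot_mapE x : quot_map x = \pi_(quotv I)%qT x.
Proof. by rewrite lfunE. Qed.

Lemma quot_map_eq0 x : (quot_map x == 0) = (x \in I).
Proof.
by rewrite -[x in RHS]subr0 -pi_quotv_eq -!quot_mapE linear0.
Qed.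

Lemma quot_map_surj (y : quotv I) : exists x, y = quot_map x.
Proof. by exists (repr y); rewrite quot_mapE reprK. Qed.

Lemma mem_preim_img (J : {vspace V}) x : (I <= J)%VS ->
  (quot_map x \in quot_map @: J)%VS = (x \in J).
Proof.
move=> IJ; apply/idP/idP => [/memv_imgP[y yJ xy]|]; last exact: memv_img.
rewrite -(subrK y x) rpredD // (subvP IJ) //.
by rewrite -quot_map_eq0 linearB /= xy subrr.
Qed.

Hypothesis Iinv : invariant_sub rho I.

Lemma quot_mapC g x : quot_rep rho I g (quot_map x) = quot_map (rho g x).
Proof. by rewrite !quot_mapE quot_repE. Qed.

(** The correspondence theorem: images and preimages under the projection
exchange the invariant subspaces of V/I with those of V that contain I. *)
Lemma irreducible_quotP : irreducible_rep (quot_rep rho I) <->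
  I <> fullv /\ forall J, invariant_sub rho J -> (I <= J)%VS ->
                  J = I \/ J = fullv.
Proof.
split=> [[nz irr]|[If maxI]].
  split=> [If|J Jinv IJ].
    case/eqP: nz; apply/eqP; rewrite -subv0; apply/subvP => y _.
    have [x ->] := quot_map_surj y.
    by rewrite memv0 quot_map_eq0 If memvf.
  have Qinv : invariant_sub (quot_rep rho I) (quot_map @: J)%VS.
    move=> g; apply/subvP => _ /memv_imgP[_ /memv_imgP[x xJ ->] ->].
    by rewrite quot_mapC !memv_img // (subvP (Jinv g)) ?memv_img.
  case: (irr _ Qinv) => E; [left|right]; apply/eqP; rewrite eqEsubv.
    rewrite IJ andbT; apply/subvP => x xJ.
    by rewrite -quot_map_eq0 -memv0 -E memv_img.
  by rewrite subvf; apply/subvP => x _; rewrite -(mem_preim_img J) // E memvf.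
split=> [|U Uinv].
  apply/eqP => Q0; apply: If; apply/eqP; rewrite eqEsubv subvf.
  by apply/subvP => x _; rewrite -quot_map_eq0 -memv0 -Q0 memvf.
have Jinv : invariant_sub rho (quot_map @^-1: U)%VS.
  move=> g; apply/subvP => _ /memv_imgP[x xJ ->].
  rewrite -memv_preim -quot_mapC (subvP (Uinv g)) // memv_img //.
  by rewrite memv_preim.
have IJ : (I <= quot_map @^-1: U)%VS.
  apply/subvP => x; rewrite -quot_map_eq0 -memv_preim => /eqP->.
  exact: mem0v.
case: (maxI _ Jinv IJ) => E; [left|right]; apply/eqP; rewrite eqEsubv.
  rewrite sub0v andbT; apply/subvP => y; have [x ->] := quot_map_surj y.
  by rewrite memv0 quot_map_eq0 memv_preim E.
rewrite subvf; apply/subvP => y _; have [x ->] := quot_map_surj y.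
by rewrite memv_preim E memvf.
Qed.

End MaximalSub.

(** * Subspaces stable under separating diagonal operators *)

Section Diagonal.
Variables (K : fieldType) (T : finType) (G : Type).
Notation F := {ffun T -> K^o}.
Variables (D : G -> 'End(F)) (e : G -> T -> K).
Hypothesis De : forall g w u, D g w u = e g u * w u.
Hypothesis e_sep : forall u v, u != v -> exists g, e g u != e g v.

(** For v <> u and a diagonal g with distinct eigenvalues at u and v, the
operator D g - e g v kills the coordinate v, only rescales the others, and keeps
the coordinate u nonzero.  Applying such operators for all v <> u in turn to w
leaves a nonzero multiple of the basis vector at u. *)
Lemma diag_sub_basis (U : {vspace F}) (w : F) (u : T) :
  invariant_sub D U -> w \in U -> w u != 0 -> [ffun v => (v == u)%:R] \in U.
Proof.
move=> Uinv wU wu.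
have kill (s : seq T) : u \notin s -> exists2 w', w' \in U &
    w' u != 0 /\ forall v, v \in s -> w' v = 0.
  elim: s => [|v s IHs]; first by exists w.
  rewrite inE negb_or => /andP[uv /IHs[w' w'U [w'u w's]]].
  have [g guv] := e_sep _ _ uv.
  exists (D g w' - e g v *: w').
    by rewrite rpredB ?rpredZ // (subvP (Uinv g)) ?memv_img.
  split=> [|x]; rewrite !ffunE De.
    by rewrite -mulrBl mulf_neq0 // subr_eq0.
  rewrite inE => /orP[/eqP->|/w's->]; first exact: subrr.
  by rewrite mulr0 scaler0 subrr.
have [|w' w'U [w'u w'0]] := kill (enum (predC1 u)).
  by rewrite mem_enum inE eqxx.
suff -> : [ffun v => (v == u)%:R] = (w' u)^-1 *: w' :> F by rewrite rpredZ.
apply/ffunP => v; rewrite !ffunE; have [->|vu] := eqVneq v u.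
  by rewrite [RHS]mulVf.
by rewrite (w'0 v) ?mem_enum ?inE // [RHS]mulr0.
Qed.

End Diagonal.

(** * Exponentials and brackets *)

Section Exponential.
Variable R : realType.

Lemma cexpD (x y : R[i]) : cexp (x + y) = cexp x * cexp y.
Proof.
case: x y => [a b] [c d]; rewrite /cexp /= expRD cosD sinD.
by apply/eqP; rewrite eq_complex /=; apply/andP; split; apply/eqP; ring.
Qed.

Lemma cexp0 : cexp (0 : R[i]) = 1.
Proof. by rewrite /cexp /= expR0 cos0 sin0 mulr1 mulr0. Qed.

Lemma cexp_neq0 (x : R[i]) : cexp x != 0.
Proof.
apply/eqP => x0; have := cexpD x (- x).
by rewrite subrr cexp0 x0 mul0r => /eqP; rewrite oner_eq0.
Qed.

Lemma cexpMn (d : nat) (x : R[i]) : cexp (d%:R * x) = cexp x ^+ d.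
Proof.
elim: d => [|d IHd]; first by rewrite mul0r cexp0.
by rewrite -natr1 mulrDl mul1r cexpD IHd exprSr.
Qed.

Lemma rt_nat (sq : nat -> R[i]) (d : nat) : rt sq d%:R = sq d.
Proof.
rewrite /rt; suff -> : complex.Re (d%:R : R[i]) = d%:R by rewrite natrK.
elim: d => [//|d IHd]; rewrite -!natr1 -IHd.
by case: (d%:R).
Qed.

Lemma natr_sub_neq (d : nat) (x y : R[i]) : x - y = d.+1%:R -> x != y.
Proof. by move=> E; rewrite -subr_eq0 E pnatr_eq0. Qed.

End Exponential.

Section KacModule.
Variables (R : realType) (p q lp lq : R[i]).
Hypotheses (p_neq0 : p != 0) (log_p : cexp lp = p) (log_q : cexp lq = q).
Hypothesis pq_generic : forall d : nat, (0 < d)%N -> ~~ d.-unity_root (p * q).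
Variable sq : nat -> R[i].
Hypothesis sqE : forall d : nat, sq d ^+ 2 = br p q lp lq d%:R.

(** The numerator q^d - p^-d vanishes only if (pq)^d = 1, and the case d = 1
shows that the denominator is not zero either. *)
Lemma br_neq0 d : (0 < d)%N -> br p q lp lq d%:R != 0.
Proof.
have pqX c : (0 < c)%N -> q ^+ c - p ^- c != 0.
  move=> c0; apply: contra (pq_generic c c0) => /eqP E.
  apply/unity_rootP; rewrite exprMn.
  by move/subr0_eq: E => ->; rewrite mulfV // expf_neq0.
move=> d0; rewrite /br mulf_neq0 //.
  rewrite /qpow /ppow cexpMn log_q mulNr -mulrN cexpMn.
  suff -> : cexp (- lp) = p^-1 by rewrite exprVn pqX.
  by apply: (mulfI p_neq0); rewrite -{1}log_p -cexpD subrr cexp0 mulfV.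
by rewrite invr_neq0 //; exact: (pqX 1%N).
Qed.

Lemma rt_neq0 d (x : R[i]) : x = d.+1%:R -> rt sq x != 0.
Proof.
move=> ->; rewrite rt_nat; apply/eqP => sq0.
by have := br_neq0 d.+1 isT; rewrite -sqE sq0 expr0n eqxx.
Qed.

Lemma pqpow_neq0 x : pqpow lp lq x != 0.
Proof. by rewrite mulf_neq0 ?cexp_neq0. Qed.

Variables (n : nat) (m13 m23 m33 a1 a2 a3 : R[i]).
Hypotheses (a1_neq0 : a1 != 0) (a2_neq0 : a2 != 0) (a3_neq0 : a3 != 0).
Hypothesis weight : m13 - m23 = n%:R.
Notation rho := (rep p q lp lq sq n m13 m23 m33 a1 a2 a3).
Notation action := (act p q lp lq sq m13 m23 m33 a1 a2 a3).

(** The position of a symbol in its block V_k, that is m11 - m22.  Naming it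
keeps the type of [tagged u], which depends on [tag u], out of the way of
rewriting. *)
Definition ix (u : label n) : nat := tagged u.

Lemma ltn_ix u : (ix u < nlab n (tag u))%N.
Proof. exact: ltn_ord. Qed.

Lemma m11E u : m11 m23 u = m22 m23 (tag u) + (ix u)%:R.
Proof. by []. Qed.

(** * Coordinates and weights *)

Lemma W_sum (w : W R n) : w = \sum_u w u *: bvec R u.
Proof.
apply/ffunP => v; rewrite sum_ffunE (bigD1 v) //= big1 => [|u uv].
  by rewrite !ffunE eqxx addr0 [RHS]mulr1.
by rewrite !ffunE eq_sym (negPf uv) scaler0.
Qed.

Lemma rep_coord g (w : W R n) v : rho g w v = \sum_u w u * action g u v.
Proof.
rewrite {1}[w]W_sum linear_sum sum_ffunE; apply: eq_bigr => u _.
by rewrite linearZ /= rep_bvec ffunE.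
Qed.

Lemma sym_coord k (x : R[i]) (v : label n) :
  sym n m23 k x v = ((tag v == k :> nat) && (m11 m23 v == x))%:R.
Proof.
rewrite /sym sum_ffunE big_mkcond (bigD1 v) //= big1 => [|u uv].
  by rewrite ffunE eqxx addr0; case: ifP.
by case: ifP => // _; rewrite ffunE eq_sym (negPf uv).
Qed.

Lemma ex_label (k i : nat) : (k < 4)%N -> (i < nlab n k)%N ->
  exists2 u : label n, tag u = k :> nat & ix u = i.
Proof. by move=> k4 ik; exists (existT _ (Ordinal k4) (Ordinal ik)). Qed.

Lemma label_eq (u v : label n) : tag u = tag v -> ix u = ix v -> u = v.
Proof.
case: u v => [k i] [k' j] /= kk'; move: j; rewrite -{}kk' => j.
by rewrite /ix /= => /val_inj->.
Qed.

(** Eigenvalues of the three generators that are used to separate the symbols,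
with a dummy value at the other generators. *)
Definition wt (g : gen) (u : label n) : R[i] :=
  match g with
  | E11 => m11 m23 u
  | E33 => m31 m33 (tag u)
  | L => (m12 m13 (tag u) - m22 m23 (tag u)) / 2
  | _ => 0
  end.

Definition cartan (i : 'I_3) : gen := tnth [tuple E11; E33; L] i.

Lemma rep_cartan i (w : W R n) u : rho (cartan i) w u = wt (cartan i) u * w u.
Proof.
have actE v : action (cartan i) v u = wt (cartan i) v * (v == u)%:R.
  have bE : sym n m23 (tag v) (m11 m23 v) u = (v == u)%:R.
    by rewrite sym_bvec ffunE eq_sym.
  rewrite -bE; case: i => [[|[|[|//]]] lti];
    rewrite /cartan (tnth_nth E11) /= ffunE; congr (_ * _); rewrite ?m11E; by field.
rewrite rep_coord (bigD1 u) //= big1 => [|v vu].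
  by rewrite actE eqxx mulr1 addr0 mulrC.
by rewrite actE (negPf vu) !mulr0.
Qed.

(** E11 separates the symbols within one block.  E33 separates the blocks
except V_1 from V_2, which have the same m31; the values of m12 - m22 there differ
by 2, so L separates them. *)
Lemma wt_sep (u v : label n) : u != v ->
  exists i, wt (cartan i) u != wt (cartan i) v.
Proof.
move=> uv; have [tuv|tuv] := eqVneq (tag u) (tag v).
  exists (@Ordinal 3 0 isT); rewrite /cartan (tnth_nth E11) /= !m11E tuv.
  rewrite (inj_eq (addrI _)) eqr_nat; apply: contra uv => /eqP iuv.
  by apply/eqP; apply: label_eq.
pose deg (k : 'I_4) := nth 0%N [:: 0; 1; 1; 2]%N k.
have m31E (k : 'I_4) : m31 m33 k = m33 + (deg k)%:R.
  by case: k => [[|[|[|[|//]]]] lt]; rewrite ?addr0.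
have [duv|duv] := eqVneq (deg (tag u)) (deg (tag v)); last first.
  exists (@Ordinal 3 1 isT); rewrite /cartan (tnth_nth E11) /= !m31E.
  by rewrite (inj_eq (addrI _)) eqr_nat.
exists (@Ordinal 3 2 isT); rewrite /cartan (tnth_nth E11) /=.
move: tuv duv; case: (tag u) (tag v)
  => [[|[|[|[|//]]]] ?] [[|[|[|[|//]]]] ?] //= _ _.
  by apply: (natr_sub_neq R 0); field.
by rewrite eq_sym; apply: (natr_sub_neq R 0); field.
Qed.

Lemma mem_basis (U : {vspace W R n}) (w : W R n) u :
  invariant_sub rho U -> w \in U -> w u != 0 -> bvec R u \in U.
Proof.
move=> Uinv; apply: (diag_sub_basis _ _ _ _ _ rep_cartan wt_sep U w u).
by move=> i; apply: Uinv.
Qed.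

Lemma mem_act (U : {vspace W R n}) g u v : invariant_sub rho U ->
  bvec R u \in U -> action g u v != 0 -> bvec R v \in U.
Proof.
move=> Uinv uU; apply: mem_basis => //.
by rewrite -rep_bvec (subvP (Uinv g)) // memv_img.
Qed.

(** * Nonzero matrix coefficients *)

Lemma m12_m11 (u : label n) :
  m12 m13 (tag u) - m11 m23 u = (nlab n (tag u) - (ix u).+1)%:R.
Proof.
rewrite m11E natrB ?ltn_ix // -[(ix u).+1%:R]natr1.
suff <- : m12 m13 (tag u) - m22 m23 (tag u) + 1 = (nlab n (tag u))%:R by ring.
by case: (tag u) => [[|[|[|[|//]]]] lt] /=; rewrite -?natr1 -weight; ring.
Qed.

Lemma act_E12_neq0 (u v : label n) :
  tag v = tag u -> ix v = (ix u).+1 -> action E12 u v != 0.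
Proof.
move=> tuv iuv; rewrite /= ffunE sym_coord tuv eqxx /=.
rewrite (_ : m11 m23 v == _); last first.
  by rewrite !m11E tuv iuv -natr1 addrA.
have ltu : ((ix u).+1 < nlab n (tag u))%N by rewrite -iuv -tuv ltn_ix.
rewrite [_ *: _]mulr1 mulf_neq0 //.
  apply: (@rt_neq0 (nlab n (tag u) - (ix u).+2)).
  by rewrite -subSn // subSS -m12_m11; ring.
by apply: (@rt_neq0 (ix u)); rewrite !m11E -natr1; ring.
Qed.

Lemma act_E21_neq0 (u v : label n) :
  tag v = tag u -> ix u = (ix v).+1 -> action E21 u v != 0.
Proof.
move=> tuv iuv; rewrite /= ffunE sym_coord tuv eqxx /=.
rewrite (_ : m11 m23 v == _); last first.
  by rewrite !m11E tuv iuv -natr1 addrA addrK.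
have ltu := ltn_ix u.
rewrite [_ *: _]mulr1 mulf_neq0 //.
  apply: (@rt_neq0 (nlab n (tag u) - (ix u).+1)).
  by rewrite -natr1 -m12_m11; ring.
by apply: (@rt_neq0 (ix v)); rewrite !m11E iuv -natr1; ring.
Qed.


Lemma coef_neq0 (u v : label n) k (c : R[i]) :
  m11 m23 u = m11 m23 v -> tag v = k :> nat -> c != 0 ->
  (c *: sym n m23 k (m11 m23 u)) v != 0.
Proof.
by move=> uv vk c0; rewrite ffunE sym_coord vk uv !eqxx [_ *: _]mulr1.
Qed.

Lemma sym_off (u v : label n) k (c x : R[i]) :
  tag v <> k :> nat -> (c *: sym n m23 k x) v = 0.
Proof.
by move/eqP=> vk; rewrite ffunE sym_coord (negPf vk) [_ *: _]mulr0.
Qed.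

Lemma two_l : 2 * ((m13 - m23) / 2) = n%:R.
Proof. by rewrite -weight; field. Qed.

Lemma two_l1 : 2 * ((m13 - m23) / 2) + 1 = n.+1%:R.
Proof. by rewrite two_l natr1. Qed.

(** The odd generators preserve m11.  As m22 drops by 1 from V_0 to V_1, the
position increases by 1 here. *)
Lemma act_01_neq0 (u v : label n) : tag u = 0%N :> nat -> tag v = 1%N :> nat ->
  ix v = (ix u).+1 -> action E32 u v != 0.
Proof.
move=> tu tv iuv.
have uv : m11 m23 u = m11 m23 v.
  by rewrite !m11E tu tv iuv /= -natr1; ring.
rewrite /act /= tu ffunE [X in _ + X]sym_off ?tv // addr0 coef_neq0 //.
rewrite mulf_neq0 ?invr_neq0 // mulf_neq0 ?invr_neq0 //.
  by apply: (rt_neq0 (ix u)); rewrite !m11E tu /= -natr1; ring.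
exact: rt_neq0 two_l1.
Qed.

Lemma act_02_neq0 (u v : label n) : tag u = 0%N :> nat -> tag v = 2%N :> nat ->
  ix v = ix u -> action E32 u v != 0.
Proof.
move=> tu tv iuv.
have uv : m11 m23 u = m11 m23 v by rewrite !m11E tu tv iuv.
have iun : (ix u < n)%N by have := ltn_ix v; rewrite -iuv tv.
rewrite /act /= tu ffunE sym_off ?tv // add0r coef_neq0 //.
rewrite mulf_neq0 //.
  by rewrite mulf_neq0 ?invr_neq0 ?pqpow_neq0.
rewrite mulf_neq0 //; last by rewrite invr_neq0 // two_l1 br_neq0.
rewrite mulf_neq0 //.
  apply: (rt_neq0 (n - ix u).-1); rewrite prednK ?subn_gt0 //.
  by rewrite natrB ?(ltnW iun) // -weight !m11E tu /=; ring.
by apply: (rt_neq0 n.-1); rewrite prednK ?two_l // (leq_ltn_trans _ iun).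
Qed.

(** The symbols of V_1 whose position lies in V_3 have m13 - m11 >= 1, which
excludes the zero of the square root of [m13 - m11]. *)
Lemma act_13_neq0 (u v : label n) : tag u = 1%N :> nat -> tag v = 3%N :> nat ->
  ix v = ix u -> action E32 u v != 0.
Proof.
move=> tu tv iuv.
have uv : m11 m23 u = m11 m23 v by rewrite !m11E tu tv iuv.
have iun : (ix u < n.+1)%N by have := ltn_ix v; rewrite -iuv tv.
rewrite /act /= tu coef_neq0 //.
rewrite mulf_neq0 //; first by rewrite !mulf_neq0 ?invr_neq0.
rewrite mulf_neq0 //; last by rewrite invr_neq0 // (rt_neq0 _ _ two_l1).
apply: (rt_neq0 (n - ix u)).
by rewrite -natr1 natrB // -weight !m11E tu /=; ring.
Qed.

Hypothesis br13 : br p q lp lq (m13 - 1 + (m33 - 1) + 3) != 0.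
Hypothesis br23 : br p q lp lq (m23 - 2 + (m33 - 1) + 3) = 0.

Lemma act_20_neq0 (u v : label n) : tag u = 2%N :> nat -> tag v = 0%N :> nat ->
  ix v = ix u -> action E23 u v != 0.
Proof.
move=> tu tv iuv.
have uv : m11 m23 u = m11 m23 v by rewrite !m11E tu tv iuv.
have iun : (ix u < n)%N by have := ltn_ix u; rewrite tu.
rewrite /act /= tu coef_neq0 //.
rewrite mulf_neq0 // mulf_neq0 //; first by rewrite mulf_neq0 ?pqpow_neq0.
rewrite mulf_neq0 ?invr_neq0 //.
  apply: (rt_neq0 (n - ix u).-1); rewrite prednK ?subn_gt0 //.
  by rewrite natrB ?(ltnW iun) // -weight !m11E tu /=; ring.
by apply: (rt_neq0 n.-1); rewrite prednK ?two_l // (leq_ltn_trans _ iun).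
Qed.

Lemma act_31_neq0 (u v : label n) : tag u = 3%N :> nat -> tag v = 1%N :> nat ->
  ix v = ix u -> action E23 u v != 0.
Proof.
move=> tu tv iuv.
have uv : m11 m23 u = m11 m23 v by rewrite !m11E tu tv iuv.
have iun : (ix u < n.+1)%N by have := ltn_ix u; rewrite tu.
rewrite /act /= tu br23 mul0r mulr0 scale0r subr0 scalerA coef_neq0 //.
rewrite mulf_neq0 //; first by rewrite mulf_neq0 ?pqpow_neq0.
rewrite mulf_neq0 // mulf_neq0 //.
  by rewrite invr_neq0 // mulf_neq0 // -log_q cexp_neq0.
rewrite mulf_neq0 //; last by rewrite invr_neq0 // (rt_neq0 _ _ two_l1).
apply: (rt_neq0 (n - ix u)).
by rewrite -natr1 natrB // -weight !m11E tu /=; ring.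
Qed.

(** The only entries from V_3 + V_1 to V_0 + V_2 carry the factor
[l23 + l33 + 3]. *)
Lemma act_odd_even g (u v : label n) :
  odd (tag u) -> ~~ odd (tag v) -> action g u v = 0.
Proof.
move=> ou ev.
have ne k : odd k -> tag v <> k :> nat by move=> + vk; rewrite -vk (negPf ev).
case: g; rewrite /act /=; try by rewrite sym_off //; exact: ne.
  move: ou; case E: (nat_of_ord (tag u)) => [|[|[|k]]] //= _.
    by rewrite br23 mulr0 scale0r ffunE.
  rewrite br23 mul0r mulr0 scale0r subr0 scalerA sym_off //; exact: ne.
move: ou; case E: (nat_of_ord (tag u)) => [|[|[|k]]] //= _.
  by rewrite sym_off //; exact: ne.
by rewrite ffunE.
Qed.

(** * The invariant subspaces *)

Lemma mem_V31 (w : W R n) :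
  reflect (forall v : label n, ~~ odd (tag v) -> w v = 0)
          (w \in V R n 3 + V R n 1)%VS.
Proof.
apply: (iffP idP) => [/memv_addP[x xV [y yV ->]] v ev|w0].
  rewrite ffunE (V_supp xV) ?(V_supp yV) ?addr0 //.
    by apply: contra ev => /eqP->.
  by apply: contra ev => /eqP->.
rewrite [w]W_sum; apply: rpred_sum => u _.
have [ou|/w0->] := boolP (odd (tag u)); last by rewrite scale0r mem0v.
apply: rpredZ.
have uV k : tag u = k :> nat -> bvec R u \in V R n k.
  by move=> uk; apply: (subvP (sumv_sup u _ (subvv _))); rewrite ?uk ?memv_line.
move: ou uV; case: (tag u) => [[|[|[|[|//]]]] ltk] //= _ uV.
  by apply: (subvP (addvSr _ _)); exact: uV.
by apply: (subvP (addvSl _ _)); exact: uV.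
Qed.

Lemma V31_inv : invariant_sub rho (V R n 3 + V R n 1)%VS.
Proof.
move=> g; apply/subvP => _ /memv_imgP[w /mem_V31 w0 ->].
apply/mem_V31 => v ev; rewrite rep_coord big1 // => u _.
have [ou|/w0->] := boolP (odd (tag u)); last by rewrite mul0r.
by rewrite act_odd_even // mulr0.
Qed.

Section Closure.
Variable U : {vspace W R n}.
Hypothesis Uinv : invariant_sub rho U.

Lemma mem_block (u v : label n) :
  bvec R u \in U -> tag v = tag u -> bvec R v \in U.
Proof.
have step d : forall x y : label n, tag y = tag x -> ix y = (ix x + d)%N ->
    (bvec R x \in U) = (bvec R y \in U).
  elim: d => [|d IHd] x y txy ixy.
    by congr (bvec R _ \in U); apply: label_eq; rewrite // ixy addn0.
  have lt4 : (tag x < 4)%N by [].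
  have ltd : (ix x + d < nlab n (tag x))%N.
    by have := ltn_ix y; rewrite txy ixy addnS; apply: ltnW.
  have [z /val_inj tz iz] := ex_label (tag x) (ix x + d) lt4 ltd.
  rewrite (IHd x z) //; apply/idP/idP => H; apply: (mem_act _ _ _ _ Uinv H).
    by apply: act_E12_neq0; rewrite ?tz // iz ixy addnS.
  by apply: act_E21_neq0; rewrite ?tz // iz ixy addnS.
move=> uU tvu; have [uv|/ltnW vu] := leqP (ix u) (ix v).
  by rewrite -(step (ix v - ix u)%N u) // subnKC.
by rewrite (step (ix u - ix v)%N v u) // subnKC.
Qed.

(** Since blocks are connected, a single nonzero entry of one generator between
two blocks suffices to pass from any symbol of the first to any symbol of the
second. *)
Lemma mem_next g (k i k' i' : nat) :
  (k < 4)%N -> (i < nlab n k)%N -> (k' < 4)%N -> (i' < nlab n k')%N ->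
  (forall u v : label n, tag u = k :> nat -> ix u = i -> tag v = k' :> nat ->
     ix v = i' -> action g u v != 0) ->
  forall u v : label n, tag u = k :> nat -> tag v = k' :> nat ->
    bvec R u \in U -> bvec R v \in U.
Proof.
move=> k4 ik k'4 ik' H u v tu tv uU.
have [x tx ix] := ex_label k i k4 ik.
have [y ty iy] := ex_label k' i' k'4 ik'.
apply: (mem_block y v); last by apply: val_inj; rewrite /= tv.
apply: (mem_act U g x y Uinv); last exact: H.
by apply: (mem_block u x) => //; apply: val_inj; rewrite /= tu.
Qed.

Lemma mem_01 (u v : label n) : tag u = 0%N :> nat -> tag v = 1%N :> nat ->
  bvec R u \in U -> bvec R v \in U.
Proof.
apply: (mem_next E32 0 0 1 1) => // x y tx ix0 ty iy1.
by apply: act_01_neq0; rewrite // ix0.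
Qed.

Lemma mem_13 (u v : label n) : tag u = 1%N :> nat -> tag v = 3%N :> nat ->
  bvec R u \in U -> bvec R v \in U.
Proof.
apply: (mem_next E32 1 0 3 0) => // x y tx ix0 ty iy0.
by apply: act_13_neq0; rewrite // ix0.
Qed.

Lemma mem_31 (u v : label n) : tag u = 3%N :> nat -> tag v = 1%N :> nat ->
  bvec R u \in U -> bvec R v \in U.
Proof.
apply: (mem_next E23 3 0 1 0) => // x y tx ix0 ty iy0.
by apply: act_31_neq0; rewrite // ix0.
Qed.

(** V_2 is zero when n = 0, so a symbol in it forces n > 0. *)
Lemma n_gt0 (u : label n) : tag u = 2%N :> nat -> (0 < n)%N.
Proof. by move=> tu; have := ltn_ix u; rewrite tu; apply: leq_ltn_trans. Qed.

Lemma mem_02 (u v : label n) : tag u = 0%N :> nat -> tag v = 2%N :> nat ->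
  bvec R u \in U -> bvec R v \in U.
Proof.
move=> tu tv; move: tu (tv).
apply: (mem_next E32 0 0 2 0) => // [|x y tx ix0 ty iy0]; first exact: n_gt0 tv.
by apply: act_02_neq0; rewrite // ix0.
Qed.

Lemma mem_20 (u v : label n) : tag u = 2%N :> nat -> tag v = 0%N :> nat ->
  bvec R u \in U -> bvec R v \in U.
Proof.
move=> tu; move: (tu).
apply: (mem_next E23 2 0 0 0) => // [|x y tx ix0 ty iy0]; first exact: n_gt0 tu.
by apply: act_20_neq0; rewrite // ix0.
Qed.

(** V_1 and V_3 lead to each other. *)
Lemma mem_odd (u v : label n) : odd (tag u) ->
  bvec R u \in U -> odd (tag v) -> bvec R v \in U.
Proof.
move=> ou uU ov; have [tvu|tvu] := eqVneq (tag v) (tag u).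
  exact: mem_block tvu.
have : (tag u != tag v :> nat) by rewrite eq_sym.
case Eu: (nat_of_ord (tag u)) (ltn_ord (tag u)) ou => [|[|[|[|//]]]] //= _ _;
  case Ev: (nat_of_ord (tag v)) (ltn_ord (tag v)) ov => [|[|[|[|//]]]] //= _ _ _.
  exact: mem_13 uU.
exact: mem_31 uU.
Qed.

(** V_0 and V_2 lead to each other, and V_0 leads to V_1, hence to V_3. *)
Lemma mem_even (u : label n) : ~~ odd (tag u) -> bvec R u \in U -> U = fullv.
Proof.
move=> eu uU.
have [x tx _] := ex_label 0 0 isT isT.
have xU : bvec R x \in U.
  case Eu: (nat_of_ord (tag u)) (ltn_ord (tag u)) eu => [|[|[|[|//]]]] //= _ _.
    by apply: mem_block uU _; apply: val_inj; rewrite /= tx.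
  exact: mem_20 uU.
have [y ty _] := ex_label 1 0 isT isT.
have yU : bvec R y \in U by apply: mem_01 xU.
apply/eqP; rewrite eqEsubv subvf; apply/subvP => w _.
rewrite [w]W_sum; apply: rpred_sum => v _; apply: rpredZ.
have [ov|] := boolP (odd (tag v)); first by apply: (mem_odd y); rewrite ?ty.
case Ev: (nat_of_ord (tag v)) (ltn_ord (tag v)) => [|[|[|[|//]]]] //= _ _.
  by apply: mem_block xU _; apply: val_inj; rewrite /= tx.
exact: mem_02 xU.
Qed.

(** Distinguish whether U contains a symbol with k even; if not, whether it
contains any symbol at all. *)
Lemma invariant_cases :
  [\/ U = 0%VS, U = (V R n 3 + V R n 1)%VS | U = fullv].
Proof.
have [/existsP[u /andP[eu uU]]|/existsPn noeven] :=
    boolP [exists u : label n, ~~ odd (tag u) && (bvec R u \in U)].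
  by constructor 3; apply: mem_even uU.
have UV : (U <= V R n 3 + V R n 1)%VS.
  apply/subvP => w wU; apply/mem_V31 => v ev; apply/eqP.
  apply: contraR (noeven v) => wv; rewrite ev.
  exact: mem_basis wU wv.
have [/existsP[u uU]|/existsPn none] :=
    boolP [exists u : label n, bvec R u \in U].
  have ou : odd (tag u) by apply: contraR (noeven u) => ->.
  constructor 2; apply/eqP; rewrite eqEsubv UV; apply/subvP => w /mem_V31 w0.
  rewrite [w]W_sum; apply: rpred_sum => v _.
  have [ov|/w0->] := boolP (odd (tag v)); last by rewrite scale0r mem0v.
  by apply: rpredZ; apply: mem_odd uU ov.
constructor 1; apply/eqP; rewrite -subv0; apply/subvP => w wU.
rewrite memv0; apply/eqP/ffunP => v; rewrite ffunE; apply/eqP.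
by apply: contraR (none v) => wv; apply: mem_basis wU wv.
Qed.

End Closure.

Lemma V31_neq0 : (V R n 3 + V R n 1)%VS <> 0%VS.
Proof.
have [y ty _] := ex_label 1 0 isT isT => V0.
have : bvec R y \in (V R n 3 + V R n 1)%VS.
  apply/mem_V31 => v ev; rewrite ffunE; case: eqP => // vy.
  by rewrite vy ty in ev.
rewrite V0 memv0 => /eqP/ffunP/(_ y)/eqP.
by rewrite !ffunE eqxx oner_eq0.
Qed.

Lemma V31_neqT : (V R n 3 + V R n 1)%VS <> fullv.
Proof.
have [x tx _] := ex_label 0 0 isT isT => VT.
have /mem_V31/(_ x) : bvec R x \in (V R n 3 + V R n 1)%VS by rewrite VT memvf.
by rewrite tx ffunE eqxx => /(_ isT)/eqP; rewrite oner_eq0.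
Qed.

Lemma irreducible_quotient_iff (I : {vspace W R n}) :
  (invariant_sub rho I /\ irreducible_rep (quot_rep rho I)) <->
  I = (V R n 3 + V R n 1)%VS.
Proof.
split=> [[Iinv]|->]; last first.
  split; first exact: V31_inv.
  apply/(irreducible_quotP _ _ _ _ _ V31_inv); split=> [|J Jinv VJ].
    exact: V31_neqT.
  case: (invariant_cases J Jinv) => E; [|by left|by right].
  by case: V31_neq0; apply/eqP; rewrite -subv0 -E.
move/(irreducible_quotP _ _ _ _ _ Iinv) => [IT maxI].
case: (invariant_cases I Iinv) => // I0.
case: (maxI _ V31_inv); first by rewrite I0 sub0v.
  by rewrite I0.
by move/V31_neqT.
Qed.

End KacModule.

Theorem mainTheorem4 (R : realType) (p q lp lq : R[i])
    (p_neq0 : p != 0) (q_neq0 : q != 0)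
    (log_p : cexp lp = p) (log_q : cexp lq = q)
    (p_generic : forall d : nat, (0 < d)%N -> ~~ d.-unity_root p)
    (q_generic : forall d : nat, (0 < d)%N -> ~~ d.-unity_root q)
    (pq_generic : forall d : nat, (0 < d)%N -> ~~ d.-unity_root (p * q))
    (sq : nat -> R[i]) (sqE : forall d : nat, sq d ^+ 2 = br p q lp lq d%:R)
    (n : nat) (m13 m23 m33 : R[i]) (weight : m13 - m23 = n%:R)
    (a1 a2 a3 : R[i]) (a1_neq0 : a1 != 0) (a2_neq0 : a2 != 0)
    (a3_neq0 : a3 != 0) :
  let l13 : R[i] := m13 - 1 in let l23 : R[i] := m23 - 2 in let l33 : R[i] := m33 - 1 in
  br p q lp lq (l13 + l33 + 3) != 0 ->
  br p q lp lq (l23 + l33 + 3) = 0 ->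
  let rho := rep p q lp lq sq n m13 m23 m33 a1 a2 a3 in
  forall I : {vspace W R n},
    (invariant_sub rho I /\ irreducible_rep (quot_rep rho I)) <->
    I = (V R n 3 + V R n 1)%VS.
Proof.
move=> l13 l23 l33 br13 br23 rho I.
exact: irreducible_quotient_iff.
Qed.
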